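(* Let $(g,G,\mathbf p)_W$ be a local holomorphic deformation of a marked map $g$. If $(g,G,\mathbf p)_W$ has the lifting property, then the spectral radius of the associated transfer operator $\mathcal A$ is at most $1$ and every eigenvalue of $\mathcal A$ of modulus one is semisimple (i.e. its algebraic multiplicity coincides with its geometric multiplicity). Moreover, for $(g,G,\mathbf p)_W$ real, the same conclusion holds assuming only the real lifting property (the lifting property with respect to real holomorphic motions).
   Context: **Marked map.** A marked map is a map $g:P_0\cup U\to\mathbb C$, where $P_0\subset\mathbb C$ is finite and $U\subset\mathbb C$ is open, together with a finite set $P\supset P_0$ such that $g(P)\subset P$, $P\setminus P_0\subset U$, $g|_U$ is holomorphic and $g'(x)\ne 0$ for $x\in P\setminus P_0$. Write $P_0=\{c_{0,1},\dots,c_{0,\nu}\}$ (distinct points), $c_{1,j}=g(c_{0,j})$, $\mathbf c_0=(c_{0,j})_j$, $\mathbf c_1=(c_{1,j})_j$. **Local holomorphic deformation.** $(g,G,\mathbf p)_W$ consists of an open connected $W\subset\mathbb C^\nu$ containing $\mathbf c_1$, a holomorphic map $\mathbf p=(p_1,\dots,p_\nu):W\to\mathbb C^\nu$ with $\mathbf p(\mathbf c_1)=\mathbf c_0$, and a holomorphic map $G:W\times U\to\mathbb C$, $(w,z)\mapsto G_w(z)$, with $G_{\mathbf c_1}=g|_U$. It is real if $P\subset\mathbb R$, $U$ and $W$ are conjugation invariant, $g(\bar z)=\overline{g(z)}$, $G_{\overline w}(\overline z)=\overline{G_w(z)}$ and $p_j(\overline w)=\overline{p_j(w)}$. **Motions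 and lifts.** A holomorphic motion $h_\lambda$ of $g(P)$ over $(\Lambda,0)$ is a family of injections $h_\lambda:g(P)\to\mathbb C$, $\lambda\in\Lambda$ (a domain containing $0$), holomorphic in $\lambda$ with $h_0=\mathrm{id}$; it is real if $\Lambda$ is symmetric with respect to $\mathbb R$ and $h_\lambda(x)\in\mathbb R$ for real $\lambda$. With $\mathbf c_1(\lambda)=(h_\lambda(c_{1,j}))_j$, a holomorphic motion $\hat h_\lambda$ of $g(P)$ is a lift of $h_\lambda$ over $\Lambda_0\ni0$ if for $\lambda\in\Lambda_0$: $\hat h_\lambda(c_{0,j})=p_j(\mathbf c_1(\lambda))$ for $c_{0,j}\in g(P)$, and $G_{\mathbf c_1(\lambda)}(\hat h_\lambda(x))=h_\lambda(g(x))$ for $x\in g(P)\setminus P_0$. The lifting property: for each holomorphic motion $h^{(0)}_\lambda$ of $g(P)$ over the unit disc $(\mathbb D,0)$ there exist $\varepsilon>0$, $M>0$ and holomorphic motions $h^{(k)}_\lambda$ ($k\ge1$) of $g(P)$ over $(\mathbb D_\varepsilon,0)$, $\mathbb D_\varepsilon=\{|\lambda|<\varepsilon\}$, such that for every $k\ge0$, $h^{(k+1)}_\lambda$ is a lift of $h^{(k)}_\lambda$ over $\mathbb D_\varepsilon$ and $|h^{(k)}_\lambda(x)|\le M$ for all $x\in g(P)$, $\lambda\in\mathbb D_\varepsilon$. The real lifting property: the same for all real $h_\lambda^{(0)}$. **Transfer operator.** $\mathcal A:\mathbb C^{\#g(P)}\to\mathbb C^{\#g(P)}$ is the linear map sending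 $\left\{\frac{d}{d\lambda}h_\lambda(x)|_{\lambda=0}\right\}_{x\in g(P)}$ to $\left\{\frac{d}{d\lambda}\hat h_\lambda(x)|_{\lambda=0}\right\}_{x\in g(P)}$ whenever $\hat h_\lambda$ is a lift of $h_\lambda$. Explicitly, $(\mathcal Av)(c_{0,j})=\sum_k\frac{\partial p_j}{\partial w_k}(\mathbf c_1)v(c_{1,k})$ for $c_{0,j}\in g(P)$ and $(\mathcal Av)(x)=\frac1{g'(x)}\Big(v(g(x))-\sum_k\frac{\partial G_w(x)}{\partial w_k}\big|_{w=\mathbf c_1}v(c_{1,k})\Big)$ for $x\in g(P)\setminus P_0$. *)

(* Defs.v *)
From HB Require Import structures.
From mathcomp Require Import all_boot all_order all_algebra.
From mathcomp Require Import finmap.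
From mathcomp Require Import all_classical all_reals topology normedtype derive.
From mathcomp Require Import complex.
Set Implicit Arguments.
Unset Strict Implicit.
Unset Printing Implicit Defensive.
Import Order.TTheory GRing.Theory Num.Theory.
Import numFieldNormedType.Exports.
Local Open Scope classical_set_scope.
Local Open Scope ring_scope.

(* The complex numbers, kept as a structure rather than as the bare type
   [R[i]] so that the library's topology and norm on numFieldTypes apply. *)
Definition C (R : realType) : numClosedFieldType := R[i].

(* Modulus with values in [R]; the library norm of [z] is its image in [C R]. *)
Definition modulus (R : realType) (z : C R) : R := ComplexField.Normc.normc z.

Definition disc (R : realType) (r : R) : set (C R) :=
  [set z | modulus z < r].

(* Only used with [D] open; differentiability is over the complex field. *)
Definition holomorphic_on (R : realType) (V W : normedModType (C R))
    (D : set V) (f : V -> W) : Prop :=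
  forall z, D z -> differentiable f z.

Definition conj_invariant (R : realType) (n : nat) (D : set 'rV[C R]_n) : Prop :=
  forall w, D w -> D (map_mx Num.conj w).

Definition conj_invariant1 (R : realType) (D : set (C R)) : Prop :=
  forall z, D z -> D z^*.

(* [marked] is the vector c_0 and [mdom] the open set U. The map is a total
   function whose values outside the union of P_0 and U are irrelevant. *)
Record markedMap (R : realType) (nu : nat) := MarkedMap {
  mfun :> C R -> C R;
  marked : 'rV[C R]_nu;
  mdom : set (C R);
  mset : {fset C R};
  marked_inj : injective (marked 0);
  marked_mset : forall j, marked 0 j \in mset;
  mset_stable : forall x, x \in mset -> mfun x \in mset;
  mdom_open : open mdom;
  mset_mdom : forall x, x \in mset -> x \notin codom (marked 0) -> mdom x;
  mfun_holomorphic : holomorphic_on mdom mfun;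
  mfun_derive_neq0 : forall x, x \in mset -> x \notin codom (marked 0) ->
    'D_1 mfun x != 0
}.

Section MarkedMap.
Context {R : realType} {nu : nat} (g : markedMap R nu).

Definition P0 : pred (C R) := mem (codom (marked g 0)).

Definition gP : {fset C R} := [fset g x | x in mset g]%fset.

Definition c1 : 'rV[C R]_nu := \row_j g (marked g 0 j).

End MarkedMap.

Record deformation (R : realType) (nu : nat) (g : markedMap R nu) :=
  Deformation {
  defW : set 'rV[C R]_nu;
  defp : 'rV[C R]_nu -> 'rV[C R]_nu;
  defG : 'rV[C R]_nu -> C R -> C R;
  defW_open : open defW;
  defW_connected : connected defW;
  defW_c1 : defW (c1 g);
  defp_holomorphic : holomorphic_on defW defp;
  defp_c1 : defp (c1 g) = marked g;
  defG_holomorphic : holomorphic_on (defW `*` mdom g)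
    (fun wz : 'rV[C R]_nu * C R => defG wz.1 wz.2);
  defG_c1 : forall z, mdom g z -> defG (c1 g) z = g z
}.

Record real_deformation (R : realType) (nu : nat) (g : markedMap R nu)
    (D : deformation g) : Prop := RealDeformation {
  real_mset : forall x, x \in mset g -> x \is Num.real;
  real_mdom : conj_invariant1 (mdom g);
  real_defW : conj_invariant (defW D);
  real_mfun : forall z, P0 g z \/ mdom g z -> g z^* = (g z)^*;
  real_defG : forall w z, defW D w -> mdom g z ->
    defG D (map_mx Num.conj w) z^* = (defG D w z)^*;
  real_defp : forall w, defW D w ->
    defp D (map_mx Num.conj w) = map_mx Num.conj (defp D w)
}.

(* A family [h] is written [h lambda x]; only the values for [lambda] in
   [L] and [x] in [X] matter. *)
Record holomorphic_motion (R : realType) (X : {fset C R}) (L : set (C R))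
    (h : C R -> C R -> C R) : Prop := HolomorphicMotion {
  motion_open : open L;
  motion_connected : connected L;
  motion_dom0 : L 0;
  motion_inj : forall l, L l -> {in X &, injective (h l)};
  motion_holomorphic : forall x, x \in X -> holomorphic_on L (h ^~ x);
  motion0 : forall x, x \in X -> h 0 x = x
}.

Record real_motion (R : realType) (X : {fset C R}) (L : set (C R))
    (h : C R -> C R -> C R) : Prop := RealMotion {
  real_motion_motion : holomorphic_motion X L h;
  real_motion_dom : conj_invariant1 L;
  real_motion_real : forall l x, L l -> l \is Num.real -> x \in X ->
    h l x \is Num.real
}.

Section Lifting.
Context {R : realType} {nu : nat} {g : markedMap R nu} (D : deformation g).

Definition c1_motion (h : C R -> C R -> C R) (l : C R) : 'rV[C R]_nu :=
  \row_j h l (c1 g 0 j).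

(* [lift_defW] and [lift_mdom] say that the two equations are meaningful:
   the deformation is only given over [defW D] and [mdom g]. *)
Record is_lift (L : set (C R)) (h hh : C R -> C R -> C R) : Prop := IsLift {
  lift_defW : forall l, L l -> defW D (c1_motion h l);
  lift_marked : forall l j, L l -> marked g 0 j \in gP g ->
    hh l (marked g 0 j) = defp D (c1_motion h l) 0 j;
  lift_mdom : forall l x, L l -> x \in gP g -> ~~ P0 g x -> mdom g (hh l x);
  lift_mfun : forall l x, L l -> x \in gP g -> ~~ P0 g x ->
    defG D (c1_motion h l) (hh l x) = h l (g x)
}.

(* [eps <= 1] because [h0] only lives over the unit disc. *)
Definition has_bounded_lifts (h0 : C R -> C R -> C R) : Prop :=
  exists (eps M : R) (h : nat -> C R -> C R -> C R),
    [/\ 0 < eps /\ eps <= 1, 0 < M, h 0%N = h0,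
        forall k, holomorphic_motion (gP g) (disc eps) (h k.+1) &
        forall k, is_lift (disc eps) (h k) (h k.+1) /\
          (forall l x, disc eps l -> x \in gP g -> modulus (h k l x) <= M)].

Definition lifting_property : Prop :=
  forall h0, holomorphic_motion (gP g) (disc 1) h0 -> has_bounded_lifts h0.

Definition real_lifting_property : Prop :=
  forall h0, real_motion (gP g) (disc 1) h0 -> has_bounded_lifts h0.

End Lifting.

Section Transfer.
Context {R : realType} {nu : nat} {g : markedMap R nu} (D : deformation g).

(* Functions on g(P) are row vectors, through an enumeration of g(P). *)
Definition gP_point (i : 'I_#|{: gP g}|) : C R := val (enum_val i).

(* The default value 0 is never used below. *)
Definition at_point (v : 'rV[C R]_#|{: gP g}|) (z : C R) : C R :=
  if insub z is Some x then v 0 (enum_rank (x : gP g)) else 0.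

Definition transfer_at (v : 'rV[C R]_#|{: gP g}|) (x : C R) : C R :=
  if [pick j | marked g 0 j == x] is Some j then
    \sum_(k < nu) 'D_(delta_mx 0 k) (fun w => defp D w 0 j) (c1 g) *
      at_point v (c1 g 0 k)
  else
    ('D_1 g x)^-1 *
      (at_point v (g x) -
       \sum_(k < nu) 'D_(delta_mx 0 k) (defG D ^~ x) (c1 g) *
         at_point v (c1 g 0 k)).

Definition transfer (v : 'rV[C R]_#|{: gP g}|) : 'rV[C R]_#|{: gP g}| :=
  \row_i transfer_at v (gP_point i).

Fact transfer_linear : linear transfer.
Proof.
have atP a u v z : at_point (a *: u + v) z = a * at_point u z + at_point v z.
  by rewrite /at_point; case: insub => [x|]; rewrite ?mxE// mulr0 addr0.
have sumP (c : 'I_nu -> C R) a u v :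
    \sum_k c k * at_point (a *: u + v) (c1 g 0 k) =
    a * (\sum_k c k * at_point u (c1 g 0 k)) +
    \sum_k c k * at_point v (c1 g 0 k).
  rewrite mulr_sumr -big_split /=; apply: eq_bigr => k _.
  by rewrite atP mulrDr mulrCA.
move=> a u v; apply/rowP => i; rewrite !mxE /transfer_at.
case: [pick j | marked g 0 j == _] => [j|]; first exact: sumP.
by rewrite sumP atP opprD addrACA -mulrBr mulrDr mulrCA.
Qed.
HB.instance Definition _ := GRing.isLinear.Build (C R) 'rV[C R]_#|{: gP g}|
  'rV[C R]_#|{: gP g}| *:%R transfer transfer_linear.

Definition transfer_mx : 'M[C R]_#|{: gP g}| := lin1_mx transfer.

Fact transfer_mxE v : v *m transfer_mx = transfer v.
Proof. exact: mul_rV_lin1. Qed.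

End Transfer.

Definition spectral_radius (R : realType) (n : nat) (A : 'M[C R]_n) : R :=
  sup [set modulus a | a in [set a | eigenvalue A a]].

(* Algebraic multiplicity equals geometric multiplicity. *)
Definition semisimple_eigenvalue (R : realType) (n : nat) (A : 'M[C R]_n)
    (a : C R) : Prop :=
  mup a (char_poly A) = \rank (eigenspace A a).

(* Main.v *)
Require Import Defs.
From mathcomp Require Import all_boot all_order all_algebra.
From mathcomp Require Import finmap.
From mathcomp Require Import all_classical all_reals topology normedtype derive.
From mathcomp Require Import sequences measure lebesgue_measure.
From mathcomp Require Import lebesgue_integral ftc exp trigo.
From mathcomp Require Import complex.
From mathcomp Require Import ring lra.
Set Implicit Arguments.
Unset Strict Implicit.
Unset Printing Implicit Defensive.
Import Order.TTheory GRing.Theory Num.Theory.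
Import numFieldNormedType.Exports.
Local Open Scope classical_set_scope.
Local Open Scope ring_scope.

(* The motion [x + l r v(x)] has velocity [r v] at [l = 0], and the velocities
   of its successive lifts are the vectors [r A^k v]. The lifts are holomorphic
   and uniformly bounded on a common disc, so Cauchy's estimate bounds all
   [A^k v]: the powers of [A] are bounded, which forbids eigenvalues outside the
   unit disc and Jordan blocks on the unit circle. In the real case this applies
   to real [v], and [v = Re v + i Im v] gives the rest.

   Holomorphic means only complex differentiable here. Cauchy's estimate comes
   from Goursat's bisection in the coordinates [z = exp(s + i t)]. With
   [q z = (f z - f 0) / z], let [P] be a primitive in [t] of [Re q] and [Q] one
   in [s] of [Im q]. By the Cauchy-Riemann equation [P - Q] has vanishing second
   differences on rectangles, so by periodicity the increment of [P] over
   [0, 2 pi] does not depend on [s]. Hence [Re q] takes a common value on any two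
   circles around 0; shrinking one of them to 0 bounds [Re (f' 0)]. *)

(** * Goursat's lemma for a pair of primitives *)

Definition second_difference {R : zmodType} (H : R -> R -> R) (s1 s2 t1 t2 : R) : R :=
  H s2 t2 - H s2 t1 - H s1 t2 + H s1 t1.

(** The intervals [[u n, u n + w / 2 ^+ n]] are nested: the left ends increase and, as the width
    halves, the right ends decrease. So the supremum of the left ends lies in all of them. In the
    bisection below this is applied to each coordinate. *)
Lemma nested_halving (R : realType) (u : nat -> R) (w : R) :
  (forall n, u n <= u n.+1 <= u n + w / 2 ^+ n.+1) ->
  forall n, u n <= sup (range u) <= u n + w / 2 ^+ n.
Proof.
move=> uS.
have up m n : (m <= n)%N -> u m <= u n.
  move=> /subnK <-; elim: (n - m)%N => [//|k IH].
  by rewrite addSn (le_trans IH)//; case/andP: (uS (k + m)%N).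
have halve n : w / 2 ^+ n.+1 + w / 2 ^+ n.+1 = w / 2 ^+ n.
  by rewrite exprS; field; rewrite expf_neq0// pnatr_eq0.
have down m n : (m <= n)%N -> u n + w / 2 ^+ n <= u m + w / 2 ^+ m.
  move=> /subnK <-; elim: (n - m)%N => [//|k IH].
  rewrite addSn (le_trans _ IH)//.
  by case/andP: (uS (k + m)%N) => _; rewrite -(halve (k + m)%N); lra.
have w0 : 0 <= w.
  have /andP[h1 h2] := uS 0%N.
  by have := le_trans h1 h2; rewrite expr1; lra.
have pos n : 0 <= w / 2 ^+ n by rewrite divr_ge0// exprn_ge0.
have ub n m : u m <= u n + w / 2 ^+ n.
  have [mn|nm] := leP m n.
    by rewrite (le_trans (up _ _ mn))// lerDl.
  by rewrite (le_trans _ (down _ _ (ltnW nm)))// lerDl.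
move=> n; apply/andP; split.
  apply: ub_le_sup; last by exists n.
  by exists (u 0%N + w / 2 ^+ 0) => _ [m _ <-]; exact: ub.
by apply: ge_sup; [exists (u n); exists n|move=> _ [m _ <-]; exact: ub].
Qed.

(* Goursat's bisection: the second difference is additive under cutting a
   rectangle, and negligible with respect to the area near every point. *)
Lemma second_difference_eq0 (R : realType) (H : R -> R -> R) (a b c d : R) :
  a <= b -> c <= d ->
  (forall s0 t0 e, a <= s0 <= b -> c <= t0 <= d -> 0 < e ->
    exists2 del, 0 < del & forall s1 s2 t1 t2,
      a <= s1 -> s1 <= s0 <= s2 -> s2 <= b ->
      c <= t1 -> t1 <= t0 <= t2 -> t2 <= d ->
      s2 - s1 < del -> t2 - t1 < del ->
      `|second_difference H s1 s2 t1 t2| <= e * ((s2 - s1) + (t2 - t1)) ^+ 2) ->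
  second_difference H a b c d = 0.
Proof.
move=> ab cd Hloc; apply: contrapT => /eqP; rewrite -normr_gt0.
set K := `|_| => K0.
set w := b - a; set l := d - c.
have w0 : 0 <= w by rewrite subr_ge0.
have l0 : 0 <= l by rewrite subr_ge0.
pose hw n := w / 2 ^+ n; pose hl n := l / 2 ^+ n.
have hwS n : hw n = hw n.+1 + hw n.+1.
  by rewrite /hw exprS; field; rewrite expf_neq0// pnatr_eq0.
have hlS n : hl n = hl n.+1 + hl n.+1.
  by rewrite /hl exprS; field; rewrite expf_neq0// pnatr_eq0.
have hw0 n : 0 <= hw n by rewrite divr_ge0// exprn_ge0.
have hl0 n : 0 <= hl n by rewrite divr_ge0// exprn_ge0.
(* A rectangle of generation [n], given by its lower corner, is bad if it keeps at least the share
   [K / 4 ^+ n] of the second difference. *)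
pose bad n (p : R * R) := [/\ a <= p.1, p.1 + hw n <= b, c <= p.2, p.2 + hl n <= d &
   K / 4 ^+ n <= `|second_difference H p.1 (p.1 + hw n) p.2 (p.2 + hl n)|].
pose good n (p q : R * R) := [/\ bad n.+1 q, p.1 <= q.1 <= p.1 + hw n.+1 &
   p.2 <= q.2 <= p.2 + hl n.+1].
have bad0 : bad 0%N (a, c).
  rewrite /bad /= /hw /hl !expr0 !divr1 /w /l !subrKC; split => //.
have step n p : bad n p -> exists q, good n p q.
  case: p => s t [/= as_ sb ct td].
  rewrite hwS hlS !addrA in sb td *.
  set x := hw n.+1 in sb *; set y := hl n.+1 in td *.
  have x0 : 0 <= x by exact: hw0. have y0 : 0 <= y by exact: hl0.
  move=> Hb.
  have E : K / 4 ^+ n = K / 4 ^+ n.+1 + K / 4 ^+ n.+1 + K / 4 ^+ n.+1 + K / 4 ^+ n.+1.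
    by rewrite exprS; field; rewrite expf_neq0// pnatr_eq0.
  have add : second_difference H s (s + x + x) t (t + y + y) =
    second_difference H s (s + x) t (t + y) +
    second_difference H s (s + x) (t + y) (t + y + y) +
    second_difference H (s + x) (s + x + x) t (t + y) +
    second_difference H (s + x) (s + x + x) (t + y) (t + y + y).
    rewrite /second_difference; ring.
  (* If all four quarters stayed below [K / 4 ^+ n.+1], their sum would stay below [K / 4 ^+ n]. *)
  have : [|| K / 4 ^+ n.+1 <= `|second_difference H s (s + x) t (t + y)|,
    K / 4 ^+ n.+1 <= `|second_difference H s (s + x) (t + y) (t + y + y)|,
    K / 4 ^+ n.+1 <= `|second_difference H (s + x) (s + x + x) t (t + y)| |
    K / 4 ^+ n.+1 <= `|second_difference H (s + x) (s + x + x) (t + y) (t + y + y)|].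
    rewrite -[_ || _]negbK !negb_or -!ltNge; apply/negP => /and4P[h1 h2 h3 h4].
    move: Hb; rewrite leNgt => /negP; apply; rewrite add.
    apply: le_lt_trans (ler_normD _ _) _.
    rewrite [ltRHS]E ltrD//.
    apply: le_lt_trans (ler_normD _ _) _; rewrite ltrD//.
    by apply: le_lt_trans (ler_normD _ _) _; rewrite ltrD.
  case/or4P => hb; [exists (s, t)|exists (s, t + y)|exists (s + x, t)|exists (s + x, t + y)];
    (split; [split => //=|move=> /=|move=> /=]); rewrite -/x -/y; lra.
(* The default [p] is never taken: every rectangle reached is bad, so a good successor exists. *)
pose nxt n p := xget p (good n p).
pose u := fix u n := if n is k.+1 then nxt k (u k) else (a, c).
have badu n : bad n (u n).
  elim: n => [//|n IH] /=; rewrite /nxt.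
  case: xgetP => [q _ []//|no]; exfalso; have [q gq] := step _ _ IH.
  exact: (no q).
have goodu n : good n (u n) (u n.+1).
  rewrite /= /nxt; case: xgetP => [q -> //|no]; exfalso.
  by have [q gq] := step _ _ (badu n); exact: (no q).
pose s0 := sup (range (fun n => (u n).1)); pose t0 := sup (range (fun n => (u n).2)).
have Hs n : (u n).1 <= s0 <= (u n).1 + hw n.
  by apply: nested_halving => m; case: (goodu m).
have Ht n : (u n).2 <= t0 <= (u n).2 + hl n.
  by apply: nested_halving => m; case: (goodu m).
have s0ab : a <= s0 <= b.
  by have := Hs 0%N; rewrite /= /hw expr0 divr1 /w subrKC.
have t0cd : c <= t0 <= d.
  by have := Ht 0%N; rewrite /= /hl expr0 divr1 /l subrKC.
(* This gives [e * (w + l) ^+ 2 < K], which contradicts badness once the rectangle is small, both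
   bounds scaling by [4 ^+ n]. The summand 1 keeps [e] positive when the rectangle is a point. *)
pose e := K / (1 + (w + l) ^+ 2) / 2.
have W0 : 0 < 1 + (w + l) ^+ 2 by rewrite ltr_pwDl// sqr_ge0.
have e0 : 0 < e by rewrite !divr_gt0.
have [del del0 Hdel] := Hloc s0 t0 e s0ab t0cd e0.
have [n Hn] : exists n, (w + l) / 2 ^+ n < del.
  have [n hn] : exists n, (w + l) / del < n%:R.
    by exists (Num.truncn ((w + l) / del)).+1; exact: truncnS_gt.
  exists n; rewrite ltr_pdivrMr ?exprn_gt0// mulrC -ltr_pdivrMr//.
  apply: lt_le_trans hn _; rewrite -natrX ler_nat; apply: ltnW; exact: ltn_expl.
have p2 : 0 < 2 ^+ n :> R by rewrite exprn_gt0.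
have hwd : hw n + hl n < del by rewrite -mulrDl.
have [b1 b2 b3 b4 b5] := badu n.
have := le_trans b5 (Hdel _ _ _ _ b1 (Hs n) b2 b3 (Ht n) b4 _ _).
rewrite ![_ + hw n]addrC ![_ + hl n]addrC !addrK.
have hwn := hw0 n; have hln := hl0 n.
have -> : hw n < del by lra.
have -> : hl n < del by lra.
move=> /(_ isT isT); apply/negP; rewrite -ltNge.
have -> : 4 ^+ n = 2 ^+ n * 2 ^+ n :> R by rewrite -exprMn; congr (_ ^+ n); ring.
have -> : e * (hw n + hl n) ^+ 2 = e * (w + l) ^+ 2 / (2 ^+ n * 2 ^+ n).
  by rewrite /hw /hl; field; rewrite gt_eqF.
rewrite ltr_pM2r ?invr_gt0 ?mulr_gt0// /e mulrAC ltr_pdivrMr//.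
rewrite mulrAC ltr_pdivrMr// -mulrA ltr_pM2l//.
by have := sqr_ge0 (w + l); lra.
Qed.

(** The error is estimated jointly in [s] and [t]: this is total differentiability with gradient
    [(p, q)], stronger than the existence of two partial derivatives. *)
Definition partials {R : numFieldType} (F : R -> R -> R) (s0 t0 p q : R) :=
  forall e, 0 < e -> exists2 del, 0 < del & forall s t,
    `|s - s0| < del -> `|t - t0| < del ->
    `|F s t - F s0 t0 - (p * (s - s0) + q * (t - t0))| <=
      e * (`|s - s0| + `|t - t0|).

Lemma partials_swap {R : numFieldType} (F : R -> R -> R) s0 t0 p q :
  partials F s0 t0 p q -> partials (fun t s => F s t) t0 s0 q p.
Proof.
move=> H e /H[del del0 Hd]; exists del => // t s ht hs.
by rewrite [q * _ + _]addrC [X in _ <= _ * X]addrC; exact: Hd.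
Qed.

Lemma partials_continuous {R : realType} (F : R -> R -> R) s0 t0 p q :
  partials F s0 t0 p q -> {for t0, continuous (F s0)}.
Proof.
move=> /(_ 1 ltr01)[del del0 H]; apply/cvgrPdist_le => e e0.
near=> t.
have td : `|t - t0| < del.
  by rewrite distrC; near: t; exact: cvgr_dist_lt.
have te : `|t - t0| <= e / (1 + `|q|).
  by rewrite distrC; near: t; apply: cvgr_dist_le => //; rewrite divr_gt0// ltr_pwDl.
have := H s0 t; rewrite subrr normr0 mulr0 !add0r => /(_ del0 td) h.
rewrite distrC -[F s0 t - F s0 t0](subrK (q * (t - t0))).
rewrite (le_trans (ler_normD _ _))// (le_trans (lerD h (lexx _)))//.
by rewrite normrM -mulrDl mulrC -ler_pdivlMr// ltr_pwDl.
Unshelve. all: by end_near. Qed.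

(** The conclusion has the form that the mean value theorem on [[c, d]] asks for: a derivative
    inside, continuity up to the ends. *)
Lemma continuous_primitive {R : realType} (f : R -> R) (c d : R) : c < d ->
  (forall t, c <= t <= d -> {for t, continuous f}) ->
  let F := fun t => parameterized_integral lebesgue_measure c t f in
  (forall t, t \in `]c, d[%R -> is_derive t 1 F (f t)) /\
  {within `[c, d], continuous F}.
Proof.
move=> cd fc F.
have fcw : {within `[c, d], continuous f}.
  by apply: continuous_in_subspaceT => t; rewrite inE /= in_itv; exact: fc.
have intf : lebesgue_measure.-integrable `[c, d] (EFin \o f).
  by apply: continuous_compact_integrable fcw; exact: segment_compact.
split; last by apply: parameterized_integral_continuous => //; exact: ltW.
move=> t; rewrite in_itv /= => /andP[ct td].
have [] := @continuous_FTC1_closed _ f c t d td intf ct; first by apply: fc; rewrite !ltW.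
by move=> dF; rewrite derive1E => <-; exact/derivableP.
Qed.

(* Mean value theorem for [P s2 - P s1] between [t1] and [t2]. *)
Lemma primitive_increment {R : realType} (F P : R -> R -> R)
    (a b c d s0 t0 p q e del : R) :
  (forall s, a <= s <= b -> (forall t, t \in `]c, d[%R -> is_derive t 1 (P s) (F s t)) /\
    {within `[c, d], continuous P s}) ->
  (forall s t, `|s - s0| < del -> `|t - t0| < del ->
    `|F s t - F s0 t0 - (p * (s - s0) + q * (t - t0))| <=
      e * (`|s - s0| + `|t - t0|)) ->
  0 <= e ->
  forall s1 s2 t1 t2, a <= s1 -> s1 <= s0 <= s2 -> s2 <= b ->
      c <= t1 -> t1 <= t0 <= t2 -> t2 <= d ->
      s2 - s1 < del -> t2 - t1 < del ->
  `|second_difference P s1 s2 t1 t2 - p * (s2 - s1) * (t2 - t1)| <=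
  2 * e * (s2 - s1 + (t2 - t1)) * (t2 - t1).
Proof.
move=> HP HF e0 s1 s2 t1 t2 as1 /andP[s10 s02] s2b ct1 /andP[t10 t02] t2d sd td.
have [d1 c1] : (forall t, t \in `]c, d[%R -> is_derive t 1 (P s1) (F s1 t)) /\
    {within `[c, d], continuous P s1} by apply: HP; lra.
have [d2 c2] : (forall t, t \in `]c, d[%R -> is_derive t 1 (P s2) (F s2 t)) /\
    {within `[c, d], continuous P s2} by apply: HP; lra.
have t12 : t1 <= t2 by lra.
have sub : `[t1, t2]%classic `<=` `[c, d]%classic.
  by move=> x /=; rewrite !in_itv /=; lra.
have cB : {within `[t1, t2], continuous (P s2 - P s1)}.
  apply: continuous_subspaceW sub _.
  by move=> x; apply: continuousD _; [exact: c2|apply: continuousN; exact: c1].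
have dB t : t \in `]t1, t2[%R -> is_derive t 1 (P s2 - P s1) (F s2 t - F s1 t).
  rewrite in_itv /= => /andP[h1 h2].
  have tcd : t \in `]c, d[%R by rewrite in_itv /=; lra.
  have := d1 t tcd; have := d2 t tcd => ? ?; exact: is_deriveB.
have [t] := MVT_segment t12 dB cB.
rewrite in_itv /= => /andP[h1 h2] E.
have {}E : P s2 t2 - P s1 t2 - (P s2 t1 - P s1 t1) = (F s2 t - F s1 t) * (t2 - t1) := E.
have -> : second_difference P s1 s2 t1 t2 - p * (s2 - s1) * (t2 - t1) =
   (F s2 t - F s1 t - p * (s2 - s1)) * (t2 - t1).
  by rewrite mulrBl -E /second_difference /=; ring.
rewrite normrM [X in _ * X <= _]ger0_norm ?subr_ge0// ler_wpM2r ?subr_ge0//.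
have hs1 : `|s1 - s0| <= s2 - s1 by rewrite ler_norml; lra.
have hs2 : `|s2 - s0| <= s2 - s1 by rewrite ler_norml; lra.
have ht : `|t - t0| <= t2 - t1 by rewrite ler_norml; lra.
have htd := le_lt_trans ht td.
have k1 := HF s1 t (le_lt_trans hs1 sd) htd.
have k2 := HF s2 t (le_lt_trans hs2 sd) htd.
(* Both values are compared with the linear approximation at [(s0, t0)]; the terms in [q] cancel
   because [t] is the same. *)
have -> : F s2 t - F s1 t - p * (s2 - s1) =
  (F s2 t - F s0 t0 - (p * (s2 - s0) + q * (t - t0))) -
  (F s1 t - F s0 t0 - (p * (s1 - s0) + q * (t - t0))) by ring.
apply: le_trans (ler_normB _ _) _.
have -> : 2 * e * (s2 - s1 + (t2 - t1)) =
  e * (s2 - s1 + (t2 - t1)) + e * (s2 - s1 + (t2 - t1)) by ring.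
apply: lerD; [apply: le_trans k2 _|apply: le_trans k1 _]; rewrite ler_wpM2l//; exact: lerD.
Qed.

(** The shared [p] is the Cauchy-Riemann equation: the [s]-derivative of [U] is the [t]-derivative
    of [V]. It makes the integrals of [U a] and [U b] over [[c, d]] equal, and the mean value
    theorem turns this into a common value. *)
Lemma periodic_mean_value {R : realType} (U V : R -> R -> R) (a b c d : R) :
  a < b -> c < d ->
  (forall s t, a <= s <= b -> c <= t <= d ->
    exists p q r, partials U s t p q /\ partials V s t r p) ->
  V ^~ c = V ^~ d ->
  exists t t', U a t = U b t'.
Proof.
move=> ab cd HUV Vper.
pose P s t := parameterized_integral lebesgue_measure c t (U s).
pose Q t s := parameterized_integral lebesgue_measure a s (V ^~ t).
have HP s : a <= s <= b -> (forall t, t \in `]c, d[%R -> is_derive t 1 (P s) (U s t)) /\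
    {within `[c, d], continuous P s}.
  move=> sab; apply: continuous_primitive => // t tcd.
  have [p [q [r [hU _]]]] := HUV s t sab tcd; exact: partials_continuous hU.
have HQ t : c <= t <= d -> (forall s, s \in `]a, b[%R -> is_derive s 1 (Q t) (V s t)) /\
    {within `[a, b], continuous Q t}.
  move=> tcd; apply: continuous_primitive => // s sab.
  have [p [q [r [_ hV]]]] := HUV s t sab tcd.
  exact: (partials_continuous (partials_swap hV)).
have : second_difference (fun s t => P s t - Q t s) a b c d = 0.
  apply: second_difference_eq0; [exact: ltW|exact: ltW|].
  move=> s0 t0 e sab tcd e0.
  have [p [q [r [hU hV]]]] := HUV s0 t0 sab tcd.
  have e20 : 0 < e / 2 by rewrite divr_gt0.
  have [del1 del10 h1] := hU _ e20.
  have [del2 del20 h2] := partials_swap hV e20.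
  exists (Num.min del1 del2); first by rewrite lt_min del10.
  move=> s1 s2 t1 t2 A1 A2 A3 A4 A5 A6.
  rewrite !lt_min => /andP[A7 A8] /andP[A9 A10].
  have k1 := primitive_increment HP h1 (ltW e20) A1 A2 A3 A4 A5 A6 A7 A9.
  have k2 := primitive_increment HQ h2 (ltW e20) A4 A5 A6 A1 A2 A3 A10 A8.
  (* The terms in [p] cancel, and the two errors, each with constant [e / 2], add up to [e] times
     the square. *)
  have -> : second_difference (fun s t => P s t - Q t s) s1 s2 t1 t2 =
    (second_difference P s1 s2 t1 t2 - p * (s2 - s1) * (t2 - t1)) -
    (second_difference Q t1 t2 s1 s2 - p * (t2 - t1) * (s2 - s1)).
    rewrite /second_difference; ring.
  apply: le_trans (ler_normB _ _) _; apply: le_trans (lerD k1 k2) _.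
  rewrite le_eqVlt; apply/orP; left; apply/eqP; by field.
rewrite /second_difference /=.
(* Periodicity removes [Q] and leaves the increments of [P a] and [P b]. *)
have -> : Q d = Q c by rewrite /Q Vper.
move=> E.
have [t _ Et] : exists2 t, t \in `]c, d[%R & P a d - P a c = U a t * (d - c).
  by have [] := HP a; [lra|move=> *; exact: MVT].
have [t' _ Et'] : exists2 t, t \in `]c, d[%R & P b d - P b c = U b t * (d - c).
  by have [] := HP b; [lra|move=> *; exact: MVT].
exists t, t'; apply: (@mulIf _ (d - c)); first by rewrite subr_eq0 gt_eqF.
rewrite -Et -Et'; lra.
Qed.

(** * Cauchy's estimate *)

Section Modulus.
Context {R : realType}.
Implicit Types (x y z : C R) (r s : R).

Lemma normE z : `|z| = (modulus z)%:C%C :> C R.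
Proof. by []. Qed.

Lemma modulusE z : modulus z = complex.Re `|z|.
Proof. by []. Qed.

Lemma modulus_ge0 z : 0 <= modulus z.
Proof. by rewrite -lecR -normE normr_ge0. Qed.

Lemma modulusM x y : modulus (x * y) = modulus x * modulus y.
Proof. exact: ComplexField.Normc.normcM. Qed.

Lemma modulusV x : modulus x^-1 = (modulus x)^-1.
Proof. exact: ComplexField.Normc.normcV. Qed.

Lemma modulusX x n : modulus (x ^+ n) = modulus x ^+ n.
Proof.
elim: n => [|n IH]; first exact: ComplexField.Normc.normc1.
by rewrite !exprS modulusM IH.
Qed.

Lemma modulusN x : modulus (- x) = modulus x.
Proof. by rewrite !modulusE normrN. Qed.

Lemma modulusD x y : modulus (x + y) <= modulus x + modulus y.
Proof. exact: le_normcD. Qed.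

Lemma modulusB x y : modulus (x - y) <= modulus x + modulus y.
Proof. by rewrite -(modulusN y); exact: modulusD. Qed.

Lemma modulus0 : modulus (0 : C R) = 0.
Proof. exact: ComplexField.Normc.normc0. Qed.

Lemma modulus_gt0 z : (0 < modulus z) = (z != 0).
Proof. by rewrite -normr_gt0 normE ltcR. Qed.

Lemma modulus_real r : modulus (r%:C%C : C R) = `|r|.
Proof. by rewrite /modulus /= expr0n /= addr0 sqrtr_sqr. Qed.

Lemma modulus_Re z : `|complex.Re z| <= modulus z.
Proof. by rewrite -lecR; exact: normc_ge_Re. Qed.

Lemma modulus_Im z : `|complex.Im z| <= modulus z.
Proof. by case: z => a b; rewrite /modulus /= -sqrtr_sqr ler_wsqrtr // lerDr sqr_ge0. Qed.

End Modulus.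

Lemma is_derive_approx (K : numFieldType) (f : K -> K) (x df : K) :
  is_derive x 1 f df -> forall e, 0 < e -> exists2 d, 0 < d & forall y,
    `|y - x| < d -> `|f y - f x - df * (y - x)| <= e * `|y - x|.
Proof.
move=> [dfx <-] e e0.
have /cvgrPdist_le /(_ e e0) :
  h^-1 *: ((f \o shift x) (h *: 1) - f x) @[h --> 0^'] --> 'D_1 f x := dfx.
move=> [d /= d0 H]; exists d => // y yd.
have [->|yx] := eqVneq y x; first by rewrite !subrr mulr0 normr0 mulr0 subrr normr0.
have h0 : y - x != 0 by rewrite subr_eq0.
have := H (y - x); rewrite /ball_ /= sub0r normrN => /(_ yd h0).
rewrite /= scaler1 subrK => h.
have -> : f y - f x - 'D_1 f x * (y - x) = - (('D_1 f x - (y - x)^-1 *: (f y - f x)) * (y - x)).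
  by rewrite mulrBl /GRing.scale /= mulrAC mulVf// mul1r opprB.
by rewrite normrN normrM ler_wpM2r.
Qed.

Lemma is_deriveC_approx {R : realType} (f : C R -> C R) (x df : C R) :
  is_derive x 1 f df -> forall e : R, 0 < e -> exists2 d : R, 0 < d & forall y,
    modulus (y - x) < d -> modulus (f y - f x - df * (y - x)) <= e * modulus (y - x).
Proof.
move=> fx e e0; have eC : 0 < e%:C%C :> C R by rewrite ltcR.
have [d d0 H] := is_derive_approx fx eC.
(* A positive element of [C R] is real, so its real part is a valid radius. *)
have dE : d = (complex.Re d)%:C%C by rewrite RRe_real// gtr0_real.
exists (complex.Re d) => [|y yd]; first by rewrite -ltcR -dE.
by rewrite -lecR rmorphM; apply: H; rewrite dE normE ltcR.
Qed.

Lemma partials_mul {R : realType} (f g : R -> R) (s0 t0 df dg : R) :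
  is_derive s0 1 f df -> is_derive t0 1 g dg ->
  partials (fun s t => f s * g t) s0 t0 (df * g t0) (f s0 * dg).
Proof.
move=> fs gt e e0.
(* [A] dominates every coefficient by which an error is multiplied below. In [e2], the bound 1
   controls the size of [g t], and the bound [e1] makes the cross term small. *)
pose A := 1 + `|g t0| + `|df| + `|f s0| + `|dg|.
have A0 : 0 < A by rewrite /A -!addrA ltr_pwDl// !addr_ge0.
pose e1 := e / (2 * A).
have e10 : 0 < e1 by rewrite divr_gt0// mulr_gt0.
have [d1 d10 H1] := is_derive_approx fs e10.
have [d2 d20 H2] := is_derive_approx gt e10.
have [d3 d30 H3] := is_derive_approx gt ltr01.
pose e2 := Num.min 1 e1.
have e20 : 0 < e2 by rewrite lt_min ltr01.
exists (Num.min d1 (Num.min d2 (Num.min d3 (e2 / A)))).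
  by rewrite !lt_min d10 d20 d30 divr_gt0.
move=> s t; rewrite !lt_min => /andP[sd1 _] /and4P[td1 td2 td3 tA].
have k1 := H1 s sd1; have k2 := H2 t td2.
have k3 : `|g t - g t0| <= e2.
  rewrite -[g t - g t0](subrK (dg * (t - t0))).
  apply: le_trans (ler_normD _ _) _; apply: le_trans (lerD (H3 t td3) (lexx _)) _.
  rewrite normrM -mulrDl.
  apply: (@le_trans _ _ (A * `|t - t0|)).
    rewrite ler_wpM2r// /A; have := normr_ge0 df; have := normr_ge0 (g t0).
    by have := normr_ge0 (f s0); lra.
  by rewrite mulrC -ler_pdivlMr// ltW.
have k4 : `|g t| <= `|g t0| + 1.
  rewrite -[g t](subrK (g t0)) addrC; apply: le_trans (ler_normD _ _) _.
  by rewrite lerD2l (le_trans k3)// ge_min lexx.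
have -> : f s * g t - f s0 * g t0 - (df * g t0 * (s - s0) + f s0 * dg * (t - t0)) =
  (f s - f s0 - df * (s - s0)) * g t + df * (s - s0) * (g t - g t0) +
  f s0 * (g t - g t0 - dg * (t - t0)) by ring.
apply: le_trans (ler_normD _ _) _.
have b3 : `|f s0 * (g t - g t0 - dg * (t - t0))| <= e * `|t - t0|.
  rewrite normrM; apply: le_trans (ler_wpM2l _ k2) _ => //.
  rewrite mulrA ler_wpM2r// /e1 mulrA ler_pdivrMr ?mulr_gt0// mulrC ler_pM2l//.
  rewrite /A; have := normr_ge0 df; have := normr_ge0 (g t0).
  by have := normr_ge0 (f s0); have := normr_ge0 dg; lra.
rewrite [leRHS]mulrDr; apply: lerD b3.
apply: le_trans (ler_normD _ _) _; rewrite !normrM.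
have b1 : `|f s - f s0 - df * (s - s0)| * `|g t| <= e1 * `|s - s0| * (`|g t0| + 1).
  exact: ler_pM.
have b2 : `|df| * `|s - s0| * `|g t - g t0| <= `|df| * `|s - s0| * e1.
  by rewrite ler_wpM2l ?mulr_ge0// (le_trans k3)// ge_min lexx orbT.
apply: le_trans (lerD b1 b2) _.
have -> : e1 * `|s - s0| * (`|g t0| + 1) + `|df| * `|s - s0| * e1 =
  e1 * (`|g t0| + 1 + `|df|) * `|s - s0| by ring.
rewrite ler_wpM2r// /e1 mulrAC ler_pdivrMr ?mulr_gt0// ler_pM2l//.
rewrite /A; have := normr_ge0 df; have := normr_ge0 (g t0).
by have := normr_ge0 (f s0); have := normr_ge0 dg; lra.
Qed.

(** * The coordinates exp(s + i t) and the Cauchy-Riemann equations *)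

Definition polar {R : realType} (s t : R) : C R :=
  (expR s * cos t +i* (expR s * sin t))%C.

Lemma modulus_polar {R : realType} (s t : R) : modulus (polar s t) = expR s.
Proof.
by rewrite /modulus /polar /= !exprMn -mulrDr cos2Dsin2 mulr1 sqrtr_sqr ger0_norm ?expR_ge0.
Qed.

Lemma modulus_le_sum {R : realType} (r s : R) : modulus (r +i* s : C R)%C <= `|r| + `|s|.
Proof.
have -> : (r +i* s : C R)%C = r%:C%C + (0 +i* s)%C by rewrite /= ; simpc.
apply: le_trans (modulusD _ _) _; rewrite modulus_real lerD2l.
by rewrite /modulus /= expr0n add0r sqrtr_sqr.
Qed.

(** The exponential is its own complex derivative; in coordinates this is the product expansion of
    [expR s * cos t] and [expR s * sin t]. *)
Lemma polar_approx {R : realType} (s0 t0 e : R) : 0 < e ->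
  exists2 del, 0 < del & forall s t, `|s - s0| < del -> `|t - t0| < del ->
    modulus (polar s t - polar s0 t0 - polar s0 t0 * ((s - s0) +i* (t - t0))%C) <=
    e * (`|s - s0| + `|t - t0|).
Proof.
move=> e0; have e20 : 0 < e / 2 by rewrite divr_gt0.
have [d1 d10 H1] := partials_mul (is_derive_expR s0) (is_derive_cos t0) e20.
have [d2 d20 H2] := partials_mul (is_derive_expR s0) (is_derive_sin t0) e20.
exists (Num.min d1 d2); first by rewrite lt_min d10.
move=> s t; rewrite !lt_min => /andP[sd1 sd2] /andP[td1 td2].
have k1 := H1 s t sd1 td1; have k2 := H2 s t sd2 td2.
rewrite /polar; simpc.
apply: le_trans (modulus_le_sum _ _) _.
have -> : e * (`|s - s0| + `|t - t0|) =
  e / 2 * (`|s - s0| + `|t - t0|) + e / 2 * (`|s - s0| + `|t - t0|) by field.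
apply: lerD; [apply: le_trans k1|apply: le_trans k2];
  rewrite le_eqVlt; apply/orP; left; apply/eqP; congr `|_|; ring.
Qed.

(** [polar] is not a map between spaces over the complex field, so the chain rule is carried out on
    the error terms. *)
Lemma polar_comp_approx {R : realType} (q : C R -> C R) (s0 t0 : R) (dq : C R) :
  is_derive (polar s0 t0) 1 q dq -> forall e, 0 < e ->
  exists2 del, 0 < del & forall s t, `|s - s0| < del -> `|t - t0| < del ->
    modulus (q (polar s t) - q (polar s0 t0) -
             dq * polar s0 t0 * ((s - s0) +i* (t - t0))%C) <=
    e * (`|s - s0| + `|t - t0|).
Proof.
move=> Dq e e0; set z0 := polar s0 t0 in Dq *.
(* [Z] will be a Lipschitz constant of [polar] at [(s0, t0)], and [B] is a positive bound for the
   modulus of [dq]. *)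
pose Z := modulus z0 + 1; have Z0 : 0 < Z by rewrite ltr_wpDl// modulus_ge0.
pose B := modulus dq + 1; have B0 : 0 < B by rewrite ltr_wpDl// modulus_ge0.
have e10 : 0 < e / 2 / Z by rewrite !divr_gt0.
have [d1 d10 H1] := is_deriveC_approx Dq e10.
pose e2 := Num.min 1 (e / 2 / B).
have e20 : 0 < e2 by rewrite lt_min ltr01 !divr_gt0.
have [d2 d20 H2] := polar_approx s0 t0 e20.
exists (Num.min d2 (d1 / (2 * Z))); first by rewrite lt_min d20 divr_gt0// mulr_gt0.
move=> s t; rewrite !lt_min => /andP[sd1 sd2] /andP[td1 td2].
have := H2 s t sd1 td1; rewrite -/z0.
set w := polar s t; set h := ((s - s0) +i* (t - t0))%C; set L := `|s - s0| + `|t - t0|.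
move=> k2.
have L0 : 0 <= L by rewrite addr_ge0.
have hL : modulus h <= L by exact: modulus_le_sum.
have wz : modulus (w - z0) <= Z * L.
  rewrite -[w - z0](subrK (z0 * h)); apply: le_trans (modulusD _ _) _.
  have -> : Z * L = L + modulus z0 * L by rewrite /Z; ring.
  apply: lerD.
    by apply: le_trans k2 _; rewrite -[leRHS]mul1r ler_wpM2r// ge_min lexx.
  by rewrite modulusM ler_wpM2l// modulus_ge0.
have wd : modulus (w - z0) < d1.
  apply: le_lt_trans wz _.
  have LL : L < d1 / (2 * Z) + d1 / (2 * Z) by rewrite ltrD.
  rewrite mulrC -ltr_pdivlMr//; apply: lt_le_trans LL _.
  by rewrite le_eqVlt; apply/orP; left; apply/eqP; field; rewrite gt_eqF.
have k1 := H1 w wd.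
have -> : q w - q z0 - dq * z0 * h = (q w - q z0 - dq * (w - z0)) + dq * (w - z0 - z0 * h).
  by ring.
apply: le_trans (modulusD _ _) _; rewrite modulusM.
have -> : e * L = e / 2 * L + e / 2 * L by field.
apply: lerD.
  apply: le_trans k1 _; apply: (@le_trans _ _ (e / 2 / Z * (Z * L))).
    by rewrite ler_wpM2l// ltW.
  by rewrite le_eqVlt; apply/orP; left; apply/eqP; field; rewrite gt_eqF.
apply: (@le_trans _ _ (B * (e / 2 / B * L))).
  apply: ler_pM; [exact: modulus_ge0|exact: modulus_ge0|by rewrite lerDl|].
  by apply: le_trans k2 _; rewrite ler_wpM2r// ge_min lexx orbT.
by rewrite le_eqVlt; apply/orP; left; apply/eqP; field; rewrite gt_eqF.
Qed.

(** The differential is multiplication by a complex number [p], so the real part has gradient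
    [(Re p, - Im p)] and the imaginary part [(Im p, Re p)]. *)
Lemma partials_polar {R : realType} (q : C R -> C R) (s0 t0 : R) :
  derivable q (polar s0 t0) 1 ->
  exists a b c, partials (fun s t => complex.Re (q (polar s t))) s0 t0 a b /\
    partials (fun s t => complex.Im (q (polar s t))) s0 t0 c a.
Proof.
move=> /derivableP Dq; set dq := 'D_1 q _ in Dq.
pose p := dq * polar s0 t0.
exists (complex.Re p), (- complex.Im p), (complex.Im p); split => e e0;
  have [d d0 H] := polar_comp_approx Dq e0; exists d => // s t hs ht;
  have {}H := H s t hs ht; apply: le_trans H.
- apply: le_trans (modulus_Re _); rewrite le_eqVlt; apply/orP; left; apply/eqP.
  congr `|_|; rewrite -/p; case: p (q _) (q _) => p1 p2 [x1 x2] [y1 y2] /=; ring.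
- apply: le_trans (modulus_Im _); rewrite le_eqVlt; apply/orP; left; apply/eqP.
  congr `|_|; rewrite -/p; case: p (q _) (q _) => p1 p2 [x1 x2] [y1 y2] /=; ring.
Qed.

Lemma discE {R : realType} (r : R) (z : C R) : disc r z = (modulus z < r).
Proof. by []. Qed.

(** The closed annulus avoids 0, so the quotient is complex differentiable there; in the coordinates
    [(s, t)] it becomes a function of period [2 pi] in [t]. The factor [c] serves to choose which
    real component is compared. *)
Lemma difference_quotient_radii {R : realType} (f : C R -> C R) (c : C R) (r a b : R) :
  holomorphic_on (disc r) f -> a < b -> expR b < r ->
  exists z w, [/\ modulus z = expR a, modulus w = expR b &
    complex.Re (c * ((f z - f 0) / z)) = complex.Re (c * ((f w - f 0) / w))].
Proof.
move=> fh ab br.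
pose q z := c * ((f z - f 0) / z).
have qd s t : a <= s <= b -> derivable q (polar s t) 1.
  move=> /andP[_ sb].
  have z0 : polar s t != 0 by rewrite -modulus_gt0 modulus_polar expR_gt0.
  have fd : derivable f (polar s t) 1.
    apply/diff_derivable/fh.
    by rewrite discE modulus_polar; apply: le_lt_trans br; rewrite ler_expR.
  have dV : derivable (fun z : C R => z^-1) (polar s t) 1.
    by apply: (@derivableV _ _ id) z0 _; exact: derivable_id.
  have dc x : derivable (cst x : C R -> C R) (polar s t) 1 by exact: derivable_cst.
  exact: derivableM (dc c) (derivableM (derivableB fd (dc (f 0))) dV).
have pi2 : 0 < pi *+ 2 :> R by rewrite pmulrn_rgt0// pi_gt0.
have [t [t' E]] : exists t t', complex.Re (q (polar a t)) = complex.Re (q (polar b t')).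
  apply: (@periodic_mean_value R (fun s t => complex.Re (q (polar s t)))
    (fun s t => complex.Im (q (polar s t))) a b 0 (pi *+ 2)) => //.
    by move=> s t sab _; apply/partials_polar/qd.
  apply/funext => s; congr (complex.Im (q _)).
  by rewrite /polar -[pi *+ 2]add0r cosD2pi sinD2pi.
by exists (polar a t), (polar b t'); split => //; exact: modulus_polar.
Qed.

(** The quotient is near [D] on a small circle and at most [2 M / (r / 2)] on the circle of radius
    [r / 2], whence the constant 4. *)
Lemma cauchy_estimate {R : realType} (f : C R -> C R) (r M : R) : 0 < r ->
  holomorphic_on (disc r) f -> (forall z, disc r z -> modulus (f z) <= M) ->
  modulus ('D_1 f 0) <= 4 * M / r.
Proof.
move=> r0 fh fM; set D := 'D_1 f 0.
have D0 : derivable f 0 1.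
  by apply/diff_derivable/fh; rewrite discE modulus0.
have [->|Dn0] := eqVneq D 0.
  rewrite modulus0 divr_ge0 ?(ltW r0)// mulr_ge0//.
  by apply: le_trans (fM 0 _); rewrite ?modulus_ge0// discE modulus0.
have mD : 0 < modulus D by rewrite modulus_gt0.
have mDJ : modulus D^* = modulus D by rewrite !modulusE norm_conjC.
(* Multiplication by [D^*] makes the derivative real and positive, so that comparing real parts
   bounds its full modulus. *)
have reD : complex.Re (D^* * D) = modulus D ^+ 2.
  by rewrite mulrC -[D * D^*]normCK normE -rmorphXn.
apply/ler_addgt0Pr => eta eta0.
have /is_deriveC_approx/(_ eta eta0)[d d0 Hd] := derivableP D0.
set b := ln (r / 2).
have eb : expR b = r / 2 by rewrite lnK// posrE divr_gt0.
(* [b - 1] keeps the inner circle inside the outer one; [ln (d / 2)] puts it within distance [d] of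
   0. *)
pose a := Num.min (b - 1) (ln (d / 2)).
have ea : expR a < d.
  apply: (@le_lt_trans _ _ (d / 2)); last by lra.
  have d20 : d / 2 \is Num.pos by rewrite posrE divr_gt0.
  by rewrite -[leRHS](lnK d20) ler_expR ge_min lexx orbT.
have ab : a < b by rewrite /a gt_min; apply/orP; left; lra.
have br : expR b < r by rewrite eb; lra.
have [z [w [mz mw E]]] := difference_quotient_radii D^* fh ab br.
have z0 : z != 0 by rewrite -modulus_gt0 mz expR_gt0.
have Hz : modulus ((f z - f 0) / z - D) <= eta.
  have := Hd z; rewrite subr0 mz => /(_ ea) h.
  have -> : (f z - f 0) / z - D = (f z - f 0 - D * z) / z by field.
  rewrite modulusM modulusV mz ler_pdivrMr ?expR_gt0//.
have Hw : modulus ((f w - f 0) / w) <= 4 * M / r.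
  rewrite modulusM modulusV mw eb ler_pdivrMr ?divr_gt0//.
  apply: le_trans (modulusB _ _) _.
  have -> : 4 * M / r * (r / 2) = M + M by field; rewrite gt_eqF.
  by apply: lerD; apply: fM; rewrite discE ?modulus0// mw.
rewrite -(ler_pM2l mD) -expr2 -reD.
have -> : D^* * D = D^* * ((f z - f 0) / z) - D^* * ((f z - f 0) / z - D) by ring.
have ReB (x y : C R) : complex.Re (x - y) = complex.Re x - complex.Re y.
  by case: x y => ? ? [? ?].
rewrite ReB E [leRHS]mulrDr; apply: lerD.
  apply: le_trans (ler_norm _) _; apply: le_trans (modulus_Re _) _.
  by rewrite modulusM mDJ ler_pM2l.
apply: le_trans (ler_norm _) _; rewrite normrN; apply: le_trans (modulus_Re _) _.
by rewrite modulusM mDJ ler_pM2l.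
Qed.

(** * Power-bounded matrices *)

Section Semisimple.
Variable F : fieldType.

(** The sizes are equal only through [e] because [S] will stack bases of a kernel and an image, and
    so has a sum of two ranks as its number of rows. *)
Lemma char_poly_similar m n (e : m = n) (S : 'M[F]_(m, n)) (A : 'M[F]_n) (N : 'M[F]_m) :
  row_free S -> S *m A = N *m S -> char_poly A = char_poly N.
Proof.
case: n / e S A => S A; rewrite row_free_unit => uS SA.
have uP : \det (map_mx polyC S) != 0.
  by rewrite det_map_mx polyC_eq0 -unitfE -unitmxE.
apply: (mulfI uP); rewrite [RHS]mulrC /char_poly -!det_mulmx; congr (\det _).
rewrite /char_poly_mx mulmxBr mulmxBl -!map_mxM SA; congr (_ - _).
by rewrite mul_mx_scalar mul_scalar_mx.
Qed.

(* Under the hypothesis the space splits as the kernel of [A - a] plus its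
   image, and [a] is no eigenvalue of the block of [A] on the image. *)
Lemma mup_char_poly_eigenspace n (A : 'M[F]_n) (a : F) :
  (forall v : 'rV[F]_n, v *m (A - a%:M) *m (A - a%:M) = 0 -> v *m (A - a%:M) = 0) ->
  mup a (char_poly A) = \rank (eigenspace A a).
Proof.
rewrite /eigenspace; set B := A - a%:M => ker2.
have AB : A = B + a%:M by rewrite subrK.
pose K := row_base (kermx B); pose I := row_base B.
(* A vector [u *m B] of the kernel satisfies [u *m B *m B = 0], hence vanishes by [ker2]. *)
have KI0 : (kermx B :&: B = 0)%MS.
  apply/eqP; rewrite -submx0; apply/rV_subP => v; rewrite sub_capmx => /andP[vK].
  move=> /submxP[u vu]; rewrite vu ker2 ?sub0mx//.
  by rewrite -vu; exact/sub_kermxP.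
have e : (\rank (kermx B) + \rank B = n)%N by rewrite mxrank_ker subnK// rank_leq_row.
have fS : row_free (col_mx K I).
  rewrite /row_free -addsmxE (adds_eqmx (eq_row_base _) (eq_row_base _)).
  by rewrite mxrank_disjoint_sum.
have KA : K *m A = a%:M *m K.
  have KB : K *m B = 0 by apply/sub_kermxP; rewrite eq_row_base.
  by rewrite AB mulmxDr KB add0r mul_mx_scalar mul_scalar_mx.
have [N IA] : exists N, I *m A = N *m I.
  apply/submxP; rewrite eq_row_base AB mulmxDr mul_mx_scalar addmx_sub ?submxMl//.
  by rewrite scalemx_sub// eq_row_base.

have SA : col_mx K I *m A = block_mx a%:M 0 0 N *m col_mx K I.
  by rewrite mul_col_mx mul_block_col !mul0mx addr0 add0r KA IA.
rewrite (char_poly_similar e fS SA) /char_poly char_block_diag_mx det_lblock.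
rewrite -!/(char_poly _) mupMl.
  rewrite char_poly_trig ?scalar_mx_is_trig//.
  under eq_bigr do rewrite mxE eqxx mulr1n.
  by rewrite prodr_const card_ord mup_XsubCX eqxx.
(* An eigenvector of [N] for [a] would give a nonzero vector [u *m I] in both the image and the
   kernel of [B]. *)
rewrite -eigenvalue_root_char; apply/eigenvalueP => -[u uN /negP]; apply.
have wB : u *m I *m B = 0.
  rewrite /B mulmxBr -[u *m I *m A]mulmxA IA mulmxA uN mul_mx_scalar -scalemxAl subrr.
  by [].
have wI : (u *m I <= kermx B :&: B)%MS.
  rewrite sub_capmx; apply/andP; split; first exact/sub_kermxP.
  by apply: submx_trans (submxMl _ _) _; rewrite eq_row_base.
move: wI; rewrite KI0 submx0 => /eqP uI0.
by apply/eqP; apply: (row_free_inj (row_base_free B)); rewrite uI0 mul0mx.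
Qed.

End Semisimple.

Section PowerBounded.
Context {R : realType} {n : nat} (A : 'M[C R]_n).

(** [B] may depend on [v], just as the radius and the bound in the lifting property depend on the
    initial motion. *)
Definition power_bounded := forall v : 'rV[C R]_n, exists B : R, forall k i,
  modulus (iter k (mulmxr A) v 0 i) <= B.

(** By Bernoulli's inequality the powers of [x > 1] grow at least linearly. *)
Lemma geometric_bound (x B : R) : (forall k : nat, x ^+ k <= B) -> x <= 1.
Proof.
move=> xB; rewrite leNgt; apply/negP => x1.
have bern k : 1 + k%:R * (x - 1) <= x ^+ k.
  elim: k => [|k IH]; first by rewrite mul0r addr0 expr0.
  rewrite exprS; apply: (@le_trans _ _ (x * (1 + k%:R * (x - 1)))).
    rewrite -natr1; have k0 : 0 <= k%:R * (x - 1) * (x - 1).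
      by rewrite !mulr_ge0// subr_ge0 ltW.
    have -> : x * (1 + k%:R * (x - 1)) = 1 + (k%:R + 1) * (x - 1) + k%:R * (x - 1) * (x - 1).
      by ring.
    by rewrite lerDl.
  by rewrite ler_pM2l// (lt_trans ltr01).
have x10 : 0 < x - 1 by rewrite subr_gt0.
have := le_trans (bern (Num.truncn (B / (x - 1))).+1) (xB _).
apply/negP; rewrite -ltNge ltr_wpDl// -ltr_pdivrMr//; exact: truncnS_gt.
Qed.

Lemma linear_bound (x B : R) : (forall k : nat, k%:R * x <= B) -> x <= 0.
Proof.
move=> xB; rewrite leNgt; apply/negP => x0.
have := xB (Num.truncn (B / x)).+1.
by apply/negP; rewrite -ltNge -ltr_pdivrMr//; exact: truncnS_gt.
Qed.

(** This is the orbit of a Jordan chain of length two; [w = 0] gives the eigenvector case. At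
    [k = 0] the truncated exponent [k.-1] is harmless, its coefficient being 0. *)
Lemma iter_eigenvector (v w : 'rV[C R]_n) (a : C R) : v *m A = a *: v + w ->
  w *m A = a *: w -> forall k,
  iter k (mulmxr A) v = a ^+ k *: v + (k%:R * a ^+ k.-1) *: w.
Proof.
move=> vA wA.
elim=> [|k IH]; first by rewrite expr0 scale1r mul0r scale0r addr0.
rewrite iterS IH /= mulmxDl -!scalemxAl vA wA !scalerDr !scalerA -addrA.
rewrite -exprSr -scalerDl; congr (_ + _ *: _).
case: k {IH} => [|k]; first by rewrite !mul0r addr0 mul1r.
by rewrite /= -mulrA -exprSr -[k.+2%:R]natr1 mulrDl mul1r addrC.
Qed.

Lemma power_bounded_eigenvalue (a : C R) : power_bounded -> eigenvalue A a ->
  modulus a <= 1.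
Proof.
move=> pb /eigenvalueP[v vA v0].
have [B HB] := pb v.
have /rV0Pn[i vi] := v0.
have mvi : 0 < modulus (v 0 i) by rewrite modulus_gt0.
apply: (@geometric_bound _ (B / modulus (v 0 i))) => k.
have := HB k i; rewrite (@iter_eigenvector _ 0 a) ?addr0// ?mul0mx ?scaler0//.
by rewrite addr0 mxE modulusM modulusX ler_pdivlMr.
Qed.

(** If [w = v *m (A - a%:M)] were a nonzero eigenvector, the term [k a^(k-1) w] would make the orbit
    of [v] grow linearly. *)
Lemma power_bounded_semisimple (a : C R) : power_bounded -> modulus a = 1 ->
  semisimple_eigenvalue A a.
Proof.
move=> pb a1; apply: mup_char_poly_eigenspace => v.
set w := v *m (A - a%:M) => wB.
have vA : v *m A = a *: v + w.
  by rewrite /w mulmxBr mul_mx_scalar subrKC.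
have wA : w *m A = a *: w.
  by apply/eqP; rewrite -subr_eq0 -mul_mx_scalar -mulmxBr wB.
have [B HB] := pb v.
apply/rowP => i; rewrite [RHS]mxE; apply/eqP; rewrite -[_ == 0]negbK -modulus_gt0 -leNgt.
apply: (@linear_bound _ (B + modulus (v 0 i))) => k.
have mk m : modulus (a ^+ m) = 1 by rewrite modulusX a1 expr1n.
have -> : k%:R * modulus (w 0 i) = modulus ((k%:R * a ^+ k.-1) * w 0 i).
  by rewrite !modulusM mk mulr1 -[k%:R in RHS](rmorph_nat (real_complex R)) modulus_real normr_nat.
have -> : k%:R * a ^+ k.-1 * w 0 i =
    iter k (mulmxr A) v 0 i - a ^+ k * v 0 i.
  by rewrite (iter_eigenvector vA wA) !mxE addrAC subrr add0r.
apply: le_trans (modulusB _ _) _; rewrite modulusM mk mul1r lerD2r; exact: HB.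
Qed.

Lemma power_bounded_spectrum : power_bounded ->
  spectral_radius A <= 1 /\
  forall a, eigenvalue A a -> modulus a = 1 -> semisimple_eigenvalue A a.
Proof.
move=> pb; split=> [|a _ a1]; last exact: power_bounded_semisimple.
rewrite /spectral_radius.
(* The spectrum is empty for a matrix of size 0, where [sup] takes its default value 0. *)
have [->|/set0P ne] :=
  eqVneq [set modulus a | a in [set a | eigenvalue A a]] set0.
  by rewrite sup0.
by apply: ge_sup => // _ [a /= ea <-]; exact: power_bounded_eigenvalue.
Qed.

End PowerBounded.

(** * Motions and the transfer operator *)

Section CurveDerivatives.
Context {K : numFieldType} {V W : normedModType K}.

Lemma is_derive_curve (c : K -> V) (F : V -> W) (x : K) (dc : V) :
  is_derive x 1 c dc -> differentiable F (c x) ->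
  is_derive x 1 (F \o c) ('d F (c x) dc).
Proof.
move=> [/derivable1_diffP Dc <-] DF.
have DFc : differentiable (F \o c) x by exact: differentiable_comp.
split; first exact/derivable1_diffP.
by rewrite !deriveE// diff_comp.
Qed.

Lemma is_derive_pair (c : K -> V) (d : K -> W) (x : K) (dc : V) (dd : W) :
  is_derive x 1 c dc -> is_derive x 1 d dd ->
  is_derive x 1 (fun l => (c l, d l)) (dc, dd).
Proof.
move=> [/derivable1_diffP Dc <-] [/derivable1_diffP Dd <-].
have Dp : differentiable (fun l => (c l, d l)) x by exact: differentiable_pair.
split; first exact/derivable1_diffP.
by rewrite !deriveE// diff_pair.
Qed.

End CurveDerivatives.

Lemma is_derive_scalel {K : numFieldType} {V : normedModType K} (f : K -> K)
    (x df : K) (v : V) :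
  is_derive x 1 f df -> is_derive x 1 (fun l => f l *: v) (df *: v).
Proof.
move=> Df.
have [Dl dl] : is_diff (f x) ( *:%R^~ v : K -> V) ( *:%R^~ v) by exact: is_diff_scalel.
by have := is_derive_curve Df Dl; rewrite dl.
Qed.

Lemma is_derive_row {K : numFieldType} {n : nat} (f : 'I_n -> K -> K) (x : K) (df : 'I_n -> K) :
  (forall i, is_derive x 1 (f i) (df i)) ->
  is_derive x 1 (fun l => \row_i f i l) (\row_i df i).
Proof.
move=> Df.
have rowE (u : 'I_n -> K) : \row_i u i = \sum_i u i *: delta_mx 0 i :> 'rV[K]_n.
  by rewrite [LHS]row_sum_delta; apply: eq_bigr => i _; rewrite mxE.
have -> : (fun l => \row_i f i l) = \sum_i (fun l => f i l *: delta_mx 0 i) :> (K -> 'rV[K]_n).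
  by apply/funext => l; rewrite rowE fct_sumE.
rewrite rowE; apply: is_derive_sum => i.
exact: is_derive_scalel.
Qed.

Lemma diff_row {K : numFieldType} {n : nat} {V : normedModType K} (F : 'rV[K]_n -> V)
    (w u : 'rV[K]_n) : differentiable F w ->
  'd F w u = \sum_i u 0 i *: 'D_(delta_mx 0 i) F w.
Proof.
move=> DF; rewrite [u in LHS]row_sum_delta linear_sum; apply: eq_bigr => i _.
by rewrite linearZ deriveE.
Qed.

Section TransferVelocity.
Context {R : realType} {nu : nat} {g : markedMap R nu} (D : deformation g).

Definition velocity (h : C R -> C R -> C R) : 'rV[C R]_#|{: gP g}| :=
  \row_i 'D_1 (h ^~ (gP_point i)) 0.

Lemma at_point_velocity h z : z \in gP g -> at_point (velocity h) z = 'D_1 (h ^~ z) 0.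
Proof.
move=> zgP; rewrite /at_point; case: insubP => [x _ xz|]; last by rewrite zgP.
by rewrite mxE /gP_point enum_rankK xz.
Qed.

Lemma gP_pointP i : @gP_point _ _ g i \in gP g.
Proof. exact: valP. Qed.

Lemma gP_mset x : x \in gP g -> x \in Defs.mset g.
Proof. by move=> /imfsetP[y /= yP ->]; exact: mset_stable. Qed.

Lemma gP_image x : x \in Defs.mset g -> g x \in gP g.
Proof. by move=> xP; apply/imfsetP; exists x. Qed.

Lemma c1_gP j : c1 g 0 j \in gP g.
Proof. by rewrite mxE; apply: gP_image; exact: marked_mset. Qed.

(** Differentiate the lift equations at 0. Off the marked points, the derivative of [G] in [w] along
    [u] plus [g' x] times the velocity of [hh] at [x] equals the velocity of [h] at [g x]; then
    divide by [g' x]. Only conditions at 0 are imposed, so that the initial motion and its lifts,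
    given over different discs, are treated alike. *)
Lemma velocity_lift (L : set (C R)) (h hh : C R -> C R -> C R) :
  nbhs 0 L ->
  (forall x, x \in gP g -> derivable (h ^~ x) 0 1 /\ h 0 x = x) ->
  (forall x, x \in gP g -> derivable (hh ^~ x) 0 1 /\ hh 0 x = x) ->
  is_lift D L h hh -> velocity hh = transfer D (velocity h).
Proof.
move=> L0 Dh Dhh lift.
have c10 : @c1_motion _ _ g h 0 = c1 g.
  by apply/rowP => j; rewrite mxE; case: (Dh _ (c1_gP j)).
pose u : 'rV[C R]_nu := \row_k at_point (velocity h) (c1 g 0 k).
have Dc1 : is_derive (0 : C R) (1 : C R) (@c1_motion _ _ g h) u.
  apply: is_derive_row => k; rewrite at_point_velocity ?c1_gP//.
  by apply/derivableP; case: (Dh _ (c1_gP k)).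
have DW : defW D (c1 g) := defW_c1 D.
apply/rowP => i; rewrite !mxE /transfer_at.
set x := gP_point i; have xgP : x \in gP g by exact: gP_pointP.
case: pickP => [j /eqP jx|xP0].
  have -> : 'D_1 (hh ^~ x) 0 = 'D_1 ((fun w => defp D w 0 j) \o @c1_motion _ _ g h) 0.
    apply: near_eq_derive; apply: filterS L0 => l Ll /=.
    by rewrite -jx (lift_marked lift Ll)// jx.
  have Dp : differentiable (fun w => defp D w 0 j) (c1 g).
    apply: (@differentiable_comp _ _ _ _ (defp D) (fun w => w 0 j)).
      exact: defp_holomorphic.
    exact: differentiable_coord.
  have := @is_derive_curve _ _ _ _ (fun w => defp D w 0 j) _ _ Dc1.
  rewrite c10 => /(_ Dp) ?; rewrite derive_val diff_row//.
  by apply: eq_bigr => k _; rewrite mxE mulrC.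
have xP : ~~ P0 g x.
  by apply/codomP => -[j xj]; have := xP0 j; rewrite -xj eqxx.
have xU : mdom g x by apply: mset_mdom => //; exact: gP_mset.
pose G (wz : 'rV[C R]_nu * C R) := defG D wz.1 wz.2.
have DG : differentiable G (c1 g, x) by exact: defG_holomorphic.
have [Dx x0] := Dhh _ xgP.
have := is_derive_curve (is_derive_pair Dc1 (derivableP Dx)) _.
move=> /(_ _ G); rewrite c10 x0 => /(_ DG) DGc.
have E1 : 'D_1 (h ^~ (g x)) 0 = 'd G (c1 g, x) (u, 'D_1 (hh ^~ x) 0).
  rewrite -[RHS](@derive_val _ _ _ _ _ _ _ DGc).
  apply: near_eq_derive; apply: filterS L0 => l Ll /=.
  by rewrite /G /= (lift_mfun lift Ll).
(* The partial differentials of [G] come from composing with the slices [w |-> (w, x)] and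
   [z |-> (c1 g, z)]. *)
have Ew v : 'd G (c1 g, x) (v, 0) = \sum_(k < nu) 'D_(delta_mx 0 k) (defG D ^~ x) (c1 g) * v 0 k.
  have Dp : is_diff (c1 g) (fun w : 'rV[C R]_nu => (w, x)) (fun w => (w, 0)).
    exact: is_diff_pair.
  have [Dp1 Dp2] := Dp.
  have DGx : differentiable (defG D ^~ x) (c1 g).
    exact: (differentiable_comp Dp1 DG).
  have -> : 'd G (c1 g, x) (v, 0) = 'd (defG D ^~ x) (c1 g) v.
    by rewrite (diff_comp Dp1 DG) /= Dp2.
  by rewrite diff_row//; apply: eq_bigr => k _; rewrite mulrC.
have Ez v : 'd G (c1 g, x) (0, v) = 'D_1 g x * v.
  have Dp : is_diff x (fun z : C R => (c1 g, z)) (fun z => (0, z)).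
    exact: is_diff_pair.
  have [Dp1 Dp2] := Dp.
  have DGx : differentiable (defG D (c1 g)) x.
    exact: (differentiable_comp Dp1 DG).
  (* The two functions agree only on [mdom g], but this is an open neighbourhood of [x]. *)
  have -> : 'D_1 g x = 'D_1 (defG D (c1 g)) x.
    apply: near_eq_derive.
    have : nbhs x (mdom g).
      by apply: open_nbhs_nbhs; split => //; exact: mdom_open.
    by apply: filterS => z zU; rewrite defG_c1.
  have -> : 'D_1 (defG D (c1 g)) x = 'd G (c1 g, x) (0, 1).
    by rewrite deriveE// (diff_comp Dp1 DG) /= Dp2.
  have {1}-> : (0, v) = v *: (0, 1) :> 'rV[C R]_nu * C R.
    by congr (_, _); rewrite /= ?scaler0//; exact/esym/mulr1.
  by rewrite linearZ /= mulrC.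
have g'0 : 'D_1 g x != 0 by apply: mfun_derive_neq0 => //; exact: gP_mset.
rewrite at_point_velocity ?gP_image ?gP_mset// E1.
have -> : (u, 'D_1 (hh ^~ x) 0) = (u, 0) + (0, 'D_1 (hh ^~ x) 0).
  by congr (_, _); rewrite /= ?addr0 ?add0r.
rewrite linearD Ew Ez addrAC.
under eq_bigr do rewrite mxE.
by rewrite subrr add0r mulKf.
Qed.

End TransferVelocity.

(** * Topology of discs *)

Section Disc.
Context {R : realType}.
Implicit Types r : R.

Lemma disc_ball r : disc r = ball (0 : C R) (r%:C%C : C R).
Proof.
by apply/seteqP; split => z; rewrite -ball_normE /ball_ /= sub0r normrN normE ltcR.
Qed.

Lemma disc_open r : 0 < r -> open (disc r).
Proof. by move=> r0; rewrite disc_ball; apply: ball_open; rewrite ltcR. Qed.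

Lemma real_segment_continuous (z : C R) : continuous (fun t : R => t%:C%C * z : C R).
Proof.
move=> t0; apply/cvgrPdist_lt => e e0.
have eE : e = (complex.Re e)%:C%C by rewrite RRe_real// gtr0_real.
have e0' : 0 < complex.Re e by rewrite -ltcR -eE.
have z0 : 0 < 1 + modulus z by rewrite ltr_pwDl// modulus_ge0.
near=> t.
have tt : `|t0 - t| < complex.Re e / (1 + modulus z).
  by near: t; apply: cvgr_dist_lt => //; rewrite divr_gt0.
rewrite -mulrBl normE eE ltcR -rmorphB modulusM modulus_real.
apply: (@le_lt_trans _ _ (`|t0 - t| * (1 + modulus z))).
  by rewrite ler_wpM2l// lerDr.
by rewrite -ltr_pdivlMr.
Unshelve. all: by end_near. Qed.

(** The disc is the union of the segments from 0 to its points, and these all contain 0. *)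
Lemma disc_connected r : connected (disc r).
Proof.
have -> : disc r = \bigcup_(z in disc r) [set (t%:C%C * z : C R) | t in `[(0 : R), 1]%classic].
  apply/seteqP; split => [z zr|_ [z zr [t /= +] <-]].
    by exists z => //; exists 1; rewrite /= ?in_itv /= ?lexx ?ler01// mul1r.
  rewrite in_itv /= => /andP[t0 t1]; rewrite discE modulusM modulus_real ger0_norm//.
  by apply: le_lt_trans zr; rewrite ler_piMl// modulus_ge0.
apply: bigcup_connected => [|z _].
  exists 0 => z _; exists 0; last by rewrite mul0r.
  by rewrite /= in_itv /= lexx ler01.
apply: connected_continuous_connected; first exact: segment_connected.
exact/continuous_subspaceT/real_segment_continuous.
Qed.

Lemma disc_nbhs0 r : 0 < r -> nbhs (0 : C R) (disc r).
Proof.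
move=> r0; apply: open_nbhs_nbhs; split; first exact: disc_open.
by rewrite discE modulus0.
Qed.

Lemma disc_conj_invariant r : conj_invariant1 (disc r).
Proof. by move=> z; rewrite !discE !modulusE norm_conjC. Qed.

End Disc.

(** * Linear motions and bounded orbits of the transfer operator *)

Section LinearMotion.
Context {R : realType} {nu : nat} {g : markedMap R nu} (D : deformation g).
Local Notation N := #|{: gP g}|.
Implicit Types (v : 'rV[C R]_N).

Lemma gP_point_surj x : x \in gP g -> exists i : 'I_N, gP_point i = x.
Proof. by move=> xgP; exists (enum_rank [` xgP]%fset); rewrite /gP_point enum_rankK. Qed.

Lemma at_gP_point v (i : 'I_N) : at_point v (gP_point i) = v 0 i.
Proof. by rewrite /at_point /gP_point valK enum_valK. Qed.

Definition linear_motion (r : R) v (l x : C R) : C R := x + l * (r%:C%C * at_point v x).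

Lemma linear_motion_is_derive r v x (l : C R) :
  is_derive l 1 ((linear_motion r v) ^~ x) (r%:C%C * at_point v x).
Proof.
rewrite /linear_motion; set c : C R := r%:C%C * _.
have := is_deriveD (is_derive_cst x l 1)
  (@is_derive_scalel (C R) (C R) id l 1 c (is_derive_id l 1)).
by rewrite add0r scale1r.
Qed.

Lemma velocity_linear_motion r v : velocity (linear_motion r v) = (r%:C%C : C R) *: v.
Proof.
apply/rowP => i; rewrite !mxE.
have := linear_motion_is_derive r v (gP_point i) 0 => ?.
by rewrite derive_val at_gP_point.
Qed.

(* The slope is chosen so that [r * |v x - v y| < |x - y|]: the sum below
   dominates every ratio (the ratios [_ / 0] being junk zeros). *)
Lemma linear_motion_holomorphic v : exists2 r : R, 0 < r &
  holomorphic_motion (gP g) (disc 1) (linear_motion r v).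
Proof.
pose ratio (i j : 'I_N) :=
  modulus (v 0 j - v 0 i) / modulus (gP_point i - gP_point j).
have ratio0 i j : 0 <= ratio i j by rewrite divr_ge0// modulus_ge0.
pose S := \sum_i \sum_j ratio i j.
have S0 : 0 <= S by rewrite !sumr_ge0// => i _; rewrite sumr_ge0.
have leS i j : ratio i j <= S.
  rewrite /S (bigD1 i)//= (bigD1 j)//= -addrA lerDl addr_ge0//.
    by rewrite sumr_ge0.
  by rewrite sumr_ge0// => ? _; rewrite sumr_ge0.
have S1 : 0 < 1 + S by rewrite ltr_pwDl.
have r0 : 0 < (1 + S)^-1 by rewrite invr_gt0.
exists (1 + S)^-1; first exact: r0.
split.
- exact: disc_open.
- exact: disc_connected.
- by rewrite discE modulus0.
- move=> l l1 _ _ /gP_point_surj[i <-] /gP_point_surj[j <-].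
  rewrite /linear_motion !at_gP_point => E; apply: contrapT => /eqP ne.
  have d0 : 0 < modulus (gP_point i - gP_point j) by rewrite modulus_gt0 subr_eq0.
  have Ed : gP_point i - gP_point j = l * ((1 + S)^-1%:C%C * (v 0 j - v 0 i)).
    have -> : gP_point i = gP_point j + l * ((1 + S)^-1%:C%C * v 0 j) -
      l * ((1 + S)^-1%:C%C * v 0 i) by rewrite -E addrK.
    by ring.
  have : modulus (gP_point i - gP_point j) < modulus (gP_point i - gP_point j).
    rewrite {1}Ed !modulusM modulus_real gtr0_norm//.
    apply: (@le_lt_trans _ _ ((1 + S)^-1 * modulus (v 0 j - v 0 i))).
      by rewrite ler_piMl ?mulr_ge0 ?modulus_ge0// ltW.
    rewrite mulrC ltr_pdivrMr// -ltr_pdivrMl// mulrC.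
    by apply: le_lt_trans (leS i j) _; rewrite ltrDr.
  by rewrite ltxx.
- move=> x _ l _; apply/derivable1_diffP.
  by have [] := linear_motion_is_derive (1 + S)^-1 v x l.
- by move=> x _; rewrite /linear_motion mul0r addr0.
Qed.

Lemma linear_motion_real r v : (forall x, x \in gP g -> x \is Num.real) ->
  (forall i, v 0 i \is Num.real) ->
  holomorphic_motion (gP g) (disc 1) (linear_motion r v) ->
  real_motion (gP g) (disc 1) (linear_motion r v).
Proof.
move=> gPr vr hm; split => //; first exact: disc_conj_invariant.
move=> l x _ lr /[dup] xgP /gPr xr; rewrite /linear_motion.
have [i <-] := gP_point_surj xgP.
rewrite at_gP_point rpredD ?rpredM//; last by apply/complex_realP; exists r.
by apply: gPr; exact: gP_pointP.
Qed.

Lemma holomorphic_motion_derivable (L : set (C R)) h x :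
  holomorphic_motion (gP g) L h -> x \in gP g -> derivable (h ^~ x) 0 1 /\ h 0 x = x.
Proof.
move=> hm xgP; split; last exact: (motion0 hm).
by apply/derivable1_diffP/(motion_holomorphic hm) => //; exact: (motion_dom0 hm).
Qed.

(* The velocities of the successive lifts are the iterates of the transfer
   operator, and Cauchy's estimate bounds them uniformly. *)
Lemma has_bounded_lifts_iter h0 : holomorphic_motion (gP g) (disc 1) h0 ->
  has_bounded_lifts D h0 -> exists B : R, forall k i,
    modulus (iter k (transfer D) (velocity h0) 0 i) <= B.
Proof.
move=> hm0 [eps [M [h [[eps0 eps1] M0 h0E hm lift]]]].
have holo k x : x \in gP g -> holomorphic_on (disc eps) (h k ^~ x).
  case: k => [|k] xgP; last exact: (motion_holomorphic (hm k)).
  (* The initial motion lives over the unit disc, which contains the present one because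
     [eps <= 1]. *)
  move=> z zeps; rewrite h0E; apply: (motion_holomorphic hm0) => //.
  exact: lt_le_trans zeps eps1.
have der k x : x \in gP g -> derivable (h k ^~ x) 0 1 /\ h k 0 x = x.
  case: k => [|k] xgP; last exact: holomorphic_motion_derivable (hm k) xgP.
  by rewrite h0E; exact: holomorphic_motion_derivable hm0 xgP.
have iterE k : iter k (transfer D) (velocity h0) = velocity (h k).
  elim: k => [|k IH]; first by rewrite h0E.
  rewrite iterS IH; apply/esym; apply: velocity_lift (der k) (der k.+1) (lift k).1.
  exact: disc_nbhs0.
exists (4 * M / eps) => k i; rewrite iterE mxE.
have igP := gP_pointP i.
by apply: cauchy_estimate => // [|z zeps]; [exact: holo|exact: (lift k).2].
Qed.

Lemma iter_transfer k v : iter k (mulmxr (transfer_mx D)) v = iter k (transfer D) v.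
Proof. by elim: k => //= k ->; rewrite transfer_mxE. Qed.

Lemma iter_transferD k a u v : iter k (transfer D) (a *: u + v) =
  a *: iter k (transfer D) u + iter k (transfer D) v.
Proof. by elim: k => //= k ->; rewrite linearP. Qed.

Lemma linear_motion_bound r v : 0 < r ->
  holomorphic_motion (gP g) (disc 1) (linear_motion r v) ->
  has_bounded_lifts D (linear_motion r v) -> exists B : R, forall k i,
    modulus (iter k (mulmxr (transfer_mx D)) v 0 i) <= B.
Proof.
move=> r0 hm /(has_bounded_lifts_iter hm)[B HB].
exists (B / r) => k i; rewrite ler_pdivlMr// iter_transfer.
have := HB k i; rewrite velocity_linear_motion -[_ *: v]addr0 iter_transferD.
have -> : iter k (transfer D) 0 = 0 by elim: k {HB} => //= k ->; rewrite linear0.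
by rewrite addr0 mxE modulusM modulus_real gtr0_norm// mulrC.
Qed.

Lemma lifting_power_bounded : lifting_property D -> power_bounded (transfer_mx D).
Proof.
move=> lp v; have [r r0 hm] := linear_motion_holomorphic v.
by apply: (linear_motion_bound r0 hm); exact: lp.
Qed.

Lemma real_lifting_power_bounded : (forall x, x \in gP g -> x \is Num.real) ->
  real_lifting_property D -> power_bounded (transfer_mx D).
Proof.
move=> gPr lp.
have real v : (forall i, v 0 i \is Num.real) -> exists B : R, forall k i,
    modulus (iter k (mulmxr (transfer_mx D)) v 0 i) <= B.
  move=> vr; have [r r0 hm] := linear_motion_holomorphic v.
  by apply: (linear_motion_bound r0 hm); apply: lp; exact: linear_motion_real.
move=> v.
have [B1 H1] : exists B : R, forall k i,
    modulus (iter k (mulmxr (transfer_mx D)) (map_mx (fun z : C R => 'Re z) v) 0 i) <= B.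
  by apply: real => i; rewrite mxE Creal_Re.
have [B2 H2] : exists B : R, forall k i,
    modulus (iter k (mulmxr (transfer_mx D)) (map_mx (fun z : C R => 'Im z) v) 0 i) <= B.
  by apply: real => i; rewrite mxE Creal_Im.
exists (B2 + B1) => k i.
(* The order of the terms matches [iter_transferD]; as ['i] has modulus 1, the two bounds simply
   add. *)
have -> : v = 'i *: map_mx (fun z : C R => 'Im z) v + map_mx (fun z : C R => 'Re z) v.
  by apply/rowP => j; rewrite !mxE addrC -Crect.
rewrite iter_transfer iter_transferD -!iter_transfer mxE.
apply: le_trans (modulusD _ _) _; apply: lerD => //.
rewrite mxE modulusM.
have -> : modulus ('i : C R) = 1 by rewrite modulusE normCi.
by rewrite mul1r.
Qed.

End LinearMotion.

Theorem proposition5p1 (R : realType) (nu : nat) (g : markedMap R nu)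
    (D : deformation g) :
  (lifting_property D ->
     spectral_radius (transfer_mx D) <= 1 /\
     forall a, eigenvalue (transfer_mx D) a -> modulus a = 1 ->
       semisimple_eigenvalue (transfer_mx D) a) /\
  (real_deformation D -> real_lifting_property D ->
     spectral_radius (transfer_mx D) <= 1 /\
     forall a, eigenvalue (transfer_mx D) a -> modulus a = 1 ->
       semisimple_eigenvalue (transfer_mx D) a).
Proof.
split=> [lp|rD lp]; apply: power_bounded_spectrum.
  exact: lifting_power_bounded.
apply: real_lifting_power_bounded lp => x /gP_mset.
exact: real_mset rD _.
Qed.
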